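(* Let $X_1,\ldots,X_n$ and $Y$ be Banach spaces. If $Y$ has the Radon-Nikodým property, then $\mathrm{QNA}(X_1,\ldots,X_n;Y)$ is dense in $\mathcal{L}(X_1,\ldots,X_n;Y)$.
   Context: Banach spaces are over $\mathbb{K}=\mathbb{R}$ or $\mathbb{C}$; $B_X$ is the closed unit ball of $X$. $\mathcal{L}(X_1,\ldots,X_n;Y)$ is the space of bounded $n$-linear maps $A\colon X_1\times\cdots\times X_n\to Y$ with norm $\|A\|=\sup\{\|A(x_1,\ldots,x_n)\|: (x_1,\ldots,x_n)\in B_{X_1}\times\cdots\times B_{X_n}\}$. $A$ quasi attains its norm, $A\in\mathrm{QNA}(X_1,\ldots,X_n;Y)$, if there is $u$ in the norm closure of $A(B_{X_1}\times\cdots\times B_{X_n})$ with $\|u\|=\|A\|$. A Banach space has the Radon-Nikodým property (RNP) if every nonempty bounded subset of it is dentable, where a set $A$ is dentable if for every $\delta>0$ there is $a\in A$ not belonging to the closed convex hull of $A\setminus\{b:\|b-a\|<\delta\}$. *)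

(* Defs.v *)
From HB Require Import structures.
From mathcomp Require Import all_boot all_order all_algebra.
From mathcomp Require Import all_classical all_reals all_analysis.
From mathcomp Require Import complex.

Set Implicit Arguments.
Unset Strict Implicit.
Unset Printing Implicit Defensive.

Import Order.TTheory GRing.Theory Num.Theory.
Import numFieldNormedType.Exports.

Local Open Scope classical_set_scope.
Local Open Scope ring_scope.

Variant scalar_kind := RealScalars | ComplexScalars.

Definition scalar_field (R : realType) (k : scalar_kind) : numFieldType :=
  match k with
  | RealScalars => R
  | ComplexScalars => R[i]
  end.

Section multilinear.
Context {K : numFieldType} {n : nat} {X : 'I_n -> normedModType K}
  {Y : normedModType K}.
Implicit Types A : (forall i, X i) -> Y.

Definition unit_balls : set (forall i, X i) :=
  [set x | forall i, `|x i| <= 1].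

Definition multilinear A :=
  forall (x : forall i, X i) (i : 'I_n),
    linear (fun v : X i => A (dfwith x i v)).

Definition bounded_multilinear : set ((forall i, X i) -> Y) :=
  [set A | multilinear A /\ bounded_set (A @` unit_balls)].

(* [K] is only partially ordered when it is the field of complex numbers, hence
   [supremum] and not [sup]; see [mnormP]. *)
Definition mnorm A : K := supremum 0 [set `|A x| | x in unit_balls].

Definition QNA : set ((forall i, X i) -> Y) :=
  [set A | bounded_multilinear A /\
    exists2 u, closure (A @` unit_balls) u & `|u| = mnorm A].

End multilinear.
Arguments bounded_multilinear {K n} X Y.
Arguments QNA {K n} X Y.

Section radon_nikodym.
Context {K : numFieldType}.

(* Convex coefficients are the elements [0 <= t <= 1] of [K]; these are real
   numbers, also when [K] is the field of complex numbers. *)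
Definition closed_convex_hull {Y : normedModType K} (A : set Y) : set Y :=
  smallest [set C : set Y | closed C /\ convex_set C] A.

Definition dentable {Y : normedModType K} (A : set Y) :=
  forall d : K, 0 < d ->
    exists2 a, A a & ~ closed_convex_hull (A `\` [set b | `|b - a| < d]) a.

Definition RNP (Y : normedModType K) :=
  forall A : set Y, A !=set0 -> bounded_set A -> dentable A.

End radon_nikodym.

Lemma realType_supremums (R : realType) (S : set R) :
  S !=set0 -> has_ubound S -> supremums S !=set0.
Proof.
move=> S0 Sb; exists (sup S).
by split => [x Sx|y Sy]; [exact: ub_le_sup|exact: ge_sup].
Qed.

Lemma complex_supremums (R : realType) (S : set R[i]) :
  S !=set0 -> has_ubound S -> S `<=` [set z | 0 <= z] -> supremums S !=set0.
Proof.
move=> S0 Sb Spos.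
have SE z : S z -> z = (complex.Re z)%:C%C.
  by move=> /Spos; case: z => a b; rewrite /= lecE /= => /andP[/eqP ->].
pose T := [set complex.Re z | z in S].
have T0 : T !=set0 by case: S0 => z Sz; exists (complex.Re z), z.
have Tb : has_ubound T.
  case: Sb => M SM; exists (complex.Re M) => _ [z Sz <-].
  by have := SM _ Sz; rewrite lecE => /andP[].
exists (sup T)%:C%C; split => [z Sz|y Sy].
  by rewrite (SE _ Sz) lecR; apply: ub_le_sup => //; exists z.
case: S0 => z Sz; rewrite lecE /=; apply/andP; split.
  by have := Sy _ Sz; rewrite (SE _ Sz) lecE /= => /andP[].
apply: ge_sup => // _ [w Sw <-].
by have := Sy _ Sw; rewrite lecE => /andP[].
Qed.

Lemma scalar_supremums (R : realType) (k : scalar_kind)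
    (S : set (scalar_field R k)) :
  S !=set0 -> has_ubound S -> S `<=` [set z | 0 <= z] ->
  supremums S (supremum 0 S).
Proof.
move=> S0 Sb Spos.
suff [m Sm] : supremums S !=set0.
  rewrite /supremum ifF; last exact/negbTE/set0P.
  by case: xgetP => [y _ //|/(_ m)].
case: k S S0 Sb Spos => S S0 Sb Spos.
  exact: (@realType_supremums R).
exact: (@complex_supremums R).
Qed.

Lemma mnormP (R : realType) (k : scalar_kind) (n : nat)
    (X : 'I_n -> normedModType (scalar_field R k))
    (Y : normedModType (scalar_field R k)) (A : (forall i, X i) -> Y) :
  bounded_set (A @` unit_balls) ->
  isLub [set `|A x| | x in unit_balls] (mnorm A).
Proof.
move=> [M0 [_ /(_ (M0 + 1))]]; rewrite ltrDl ltr01 => /(_ isT) AM.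
suff [] : supremums [set `|A x| | x in unit_balls] (mnorm A) by split.
apply: scalar_supremums.
- by exists `|A (fun=> 0)|, (fun=> 0) => // i /=; rewrite normr0.
- by exists (M0 + 1) => _ [x xB <-]; apply: AM; exists x.
- by move=> _ [x _ <-] /=.
Qed.

(* Main.v *)
(* Choose [y0] in the closure [D] of the image of [A], and a real-linear
   functional [h] on [Y] of small norm, such that [|y| + h y] is maximal on [D]
   at [y0]. If [g] is the scalar functional with real part [h], the rank-one
   perturbation [B x = A x + g (A x) y0 / |y0|] satisfies
   [|B x| <= |A x| + h (w A x)] for some unimodular [w], and [w A x] is in [D];
   hence [|B x| <= |y0| + h y0], which is reached at the limit point
   [y0 + g y0 y0 / |y0|] of the image of [B].
   The pair [(h, y0)] comes from Stegall's variational principle: slices of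
   arbitrarily small diameter are obtained by successive small perturbations.
   If no small perturbation had a small slice, the almost maximisers would form
   an approximate bush, and replacing each node by the limit of the barycentres
   of its descendants would give a bounded set that is not dentable. *)
Require Import Defs.
From HB Require Import structures.
From mathcomp Require Import all_boot all_order all_algebra.
From mathcomp Require Import all_classical all_reals all_analysis.
From mathcomp Require Import complex lra ring.
Set Implicit Arguments.
Unset Strict Implicit.
Unset Printing Implicit Defensive.
Import Order.TTheory GRing.Theory Num.Theory.
Import numFieldNormedType.Exports.
Local Open Scope classical_set_scope.
Local Open Scope ring_scope.

(** * The Hahn-Banach theorem for real-linear functionals on real or complex spaces *)

Section hahn_banach.
Context {R : realType} {K : nzRingType} {V : lmodType K} (j : {rmorphism R -> K}).
Implicit Types (p q : V -> R) (W : set (V * R)).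

(** Homogeneity is only an inequality, which is easier to check for infima; applied to [t] and
    [t^-1] it gives equality for [t > 0]. *)
Definition sublinear q :=
  (forall x y, q (x + y) <= q x + q y) /\
  (forall t x, 0 <= t -> q (j t *: x) <= t * q x).

Definition real_linear (l : V -> R) :=
  (forall x y, l (x + y) = l x + l y) /\ (forall t x, l (j t *: x) = t * l x).

Lemma sublinear_ge0 q : sublinear q -> 0 <= q 0.
Proof. by case=> + _ => /(_ 0 0); rewrite addr0; lra. Qed.

Lemma sublinear_geN q x : sublinear q -> - q (- x) <= q x.
Proof.
move=> sq; have := sublinear_ge0 sq.
by case: sq => + _ => /(_ x (- x)); rewrite subrr; lra.
Qed.

(* [p] is the infimal convolution [inf_(w in W) (q (x + w.1) + w.2)]. *)
Lemma sublinear_cone q W : sublinear q -> W (0, 0) ->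
  (forall v w, W v -> W w -> W (v.1 + w.1, v.2 + w.2)) ->
  (forall t w, 0 <= t -> W w -> W (j t *: w.1, t * w.2)) ->
  (forall w, W w -> 0 <= q w.1 + w.2) ->
  exists p, [/\ sublinear p, forall x, p x <= q x &
                forall w, W w -> p (- w.1) <= w.2].
Proof.
move=> sq W0 WD WZ Wq; have [qD qZ] := sq.
pose S x := [set q (x + w.1) + w.2 | w in W].
have S0 x : S x !=set0 by exists (q (x + 0) + 0), (0, 0).
(* Subadditivity gives [q (x + w.1) + q (- x) >= q w.1 >= - w.2]. *)
have Sb x : has_lbound (S x).
  exists (- q (- x)) => _ [w Ww <-].
  have := qD (x + w.1) (- x); rewrite addrAC subrr add0r.
  by have := Wq _ Ww; lra.
have Sle x w : W w -> inf (S x) <= q (x + w.1) + w.2.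
  by move=> Ww; apply: ge_inf => //; exists w.
exists (fun x => inf (S x)); split.
- split=> [x y|t x t0].
    rewrite -lerBlDr; apply: lb_le_inf => // _ [v Wv <-].
    rewrite lerBlDr -lerBlDl; apply: lb_le_inf => // _ [w Ww <-].
    rewrite lerBlDl; apply: le_trans (Sle _ _ (WD _ _ Wv Ww)) _.
    rewrite /= addrACA; have := qD (x + v.1) (y + w.1); lra.
  have [t_gt0|t_le0] := ltP 0 t.
    rewrite mulrC -ler_pdivrMr//; apply: lb_le_inf => // _ [w Ww <-].
    rewrite ler_pdivrMr//; apply: le_trans (Sle _ _ (WZ _ _ t0 Ww)) _.
    by rewrite /= -scalerDr; have := qZ t (x + w.1) t0; lra.
  have -> : t = 0 by lra.
  rewrite rmorph0 scale0r mul0r; apply: le_trans (Sle _ _ W0) _ => /=.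
  by rewrite !addr0; have := qZ 0 0 (lexx _); rewrite rmorph0 scale0r mul0r.
- by move=> x; apply: le_trans (Sle _ _ W0) _; rewrite /= !addr0.
- move=> w Ww; apply: le_trans (Sle _ _ Ww) _; rewrite addNr.
  by have := qZ 0 0 (lexx _); rewrite rmorph0 scale0r mul0r; lra.
Qed.

(** Zorn's lemma for the reverse pointwise order: the infimum of a chain stays subadditive because
    two members of the chain can be replaced by the smaller one. *)
Lemma minimal_sublinear q : sublinear q ->
  exists m, [/\ sublinear m, forall x, m x <= q x &
    forall p, sublinear p -> (forall x, p x <= m x) -> p = m].
Proof.
move=> sq.
pose T := {p | sublinear p /\ forall x, p x <= q x}.
pose le (p1 p2 : T) := `[< forall x, sval p2 x <= sval p1 x >].
have [||||[m [sm mq]] mmax] := @Zorn T le.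
- by move=> p; apply/asboolP.
- move=> p1 p2 p3 /asboolP le12 /asboolP le23; apply/asboolP => x.
  exact: le_trans (le23 x) (le12 x).
- move=> [p1 P1] [p2 P2] /asboolP/= le12 /asboolP/= le21.
  have E : p1 = p2 by apply/funext => x; apply/eqP; rewrite eq_le le12 le21.
  by rewrite E in P1 le12 le21 *; congr exist; exact: Prop_irrelevance.
- move=> C Ctot; have [[p0 Cp0]|C0] := pselect (C !=set0); last first.
    (* The empty chain is bounded by [q] itself. *)
    by exists (exist _ q (conj sq (fun x => lexx (q x)))) => s Cs; case: C0; exists s.
  pose S x := [set sval p x | p in C].
  have S0 x : S x !=set0 by exists (sval p0 x), p0.
  have Sb x : has_lbound (S x).
    exists (- q (- x)) => _ [[p [sp pq]] _ <-] /=.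
    by have := sublinear_geN x sp; have := pq (- x); lra.
  have Sle x (p : T) : C p -> inf (S x) <= sval p x.
    by move=> Cp; apply: ge_inf => //; exists p.
  have sm : sublinear (fun x => inf (S x)).
    split=> [x y|t x t0].
      rewrite -lerBlDr; apply: lb_le_inf => // _ [p1 C1 <-].
      rewrite lerBlDr -lerBlDl; apply: lb_le_inf => // _ [p2 C2 <-].
      rewrite lerBlDl.
      have [/asboolP le12|/asboolP le21] := Ctot _ _ C1 C2.
        have := Sle (x + y) _ C2; have := (svalP p2).1.1 x y.
        by have := le12 x; lra.
      have := Sle (x + y) _ C1; have := (svalP p1).1.1 x y.
      by have := le21 y; lra.
    have [t_gt0|t_le0] := ltP 0 t.
      rewrite mulrC -ler_pdivrMr//; apply: lb_le_inf => // _ [p Cp <-].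
      rewrite ler_pdivrMr//; apply: le_trans (Sle _ _ Cp) _.
      by have := (svalP p).1.2 t x t0; lra.
    have t_eq0 : t = 0 by lra.
    apply: le_trans (Sle _ _ Cp0) _; have := (svalP p0).1.2 t x t0.
    by rewrite t_eq0 !mul0r.
  have mq x : inf (S x) <= q x.
    exact: le_trans (Sle _ _ Cp0) ((svalP p0).2 x).
  exists (exist _ (fun x => inf (S x)) (conj sm mq)) => p Cp; apply/asboolP => x; exact: Sle.
exists m; split => // p sp pm.
have pq x : p x <= q x by apply: le_trans (pm x) (mq x).
by have /(congr1 sval) := mmax (exist _ p (conj sp pq)) (asboolT pm).
Qed.

(** A minimal sublinear functional [m] is linear. Its infimal convolution along the ray spanned by
    [(y, - m y)] lies below [m], so equals [m], and this forces [m (- y) <= - m y]. Oddness then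
    turns the sublinear inequalities into equalities. *)
Lemma hahn_banach q : sublinear q ->
  exists2 l, real_linear l & forall x, l x <= q x.
Proof.
move=> /minimal_sublinear[m [sm mq mmin]]; exists m => //.
have [mD mZ] := sm.
have m0 : m 0 = 0.
  have := sublinear_ge0 sm; have := mZ 0 0 (lexx _).
  by rewrite rmorph0 scale0r mul0r; lra.
have mN y : m (- y) = - m y.
  pose W := [set w | exists2 t, 0 <= t & w = (j t *: y, - (t * m y))].
  have [||||p [sp pm pW]] := @sublinear_cone m W sm.
  - by exists 0 => //; rewrite rmorph0 scale0r mul0r oppr0.
  - move=> _ _ [s s0 ->] [t t0 ->]; exists (s + t); first exact: addr_ge0.
    by rewrite rmorphD scalerDl mulrDl opprD.
  - move=> t _ t0 [s s0 ->]; exists (t * s); first exact: mulr_ge0.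
    by rewrite rmorphM scalerA mulrN mulrA.
  - move=> _ [t t0 ->] /=; rewrite le_eqVlt in t0.
    have [/eqP <-|t_gt0] := orP t0; first by rewrite rmorph0 scale0r m0 mul0r subrr.
    have := mZ t^-1 (j t *: y); rewrite invr_ge0 ltW// => /(_ isT).
    rewrite scalerA -rmorphM mulVf ?gt_eqF// rmorph1 scale1r => h.
    by rewrite subr_ge0 -ler_pdivlMl.
  have := pW (j 1 *: y, - (1 * m y)); rewrite (mmin _ sp pm) rmorph1 scale1r mul1r.
  move=> /(_ _)/= h; have := sublinear_geN (- y) sm; rewrite opprK.
  have : m (- y) <= - m y by apply: h; exists 1; rewrite // rmorph1 scale1r mul1r.
  lra.
have mZ' t x : 0 <= t -> m (j t *: x) = t * m x.
  move=> t0; apply/eqP; rewrite eq_le mZ//=.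
  have := mZ t (- x) t0; rewrite scalerN !mN; lra.
split=> [x y|t x].
  apply/eqP; rewrite eq_le mD/=.
  by have := mD (x + y) (- y); rewrite addrK mN; lra.
have [|t0] := leP 0 t; first exact: mZ'.
have := @mZ' (- t) x; rewrite rmorphN scaleNr mN => E.
have : - m (j t *: x) = - t * m x by apply: E; lra.
lra.
Qed.

End hahn_banach.

(** * Uniform treatment of real and complex scalars *)

Section scalars.
Context {R : realType} {k : scalar_kind}.
Local Notation K := (scalar_field R k).

Definition real_scalar : {rmorphism R -> K} :=
  match k with
  | RealScalars => idfun
  | ComplexScalars => real_complex R
  end.

Definition re_scalar : K -> R :=
  match k with
  | RealScalars => id
  | ComplexScalars => @complex.Re R
  end.

Lemma real_scalarK r : re_scalar (real_scalar r) = r.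
Proof. by rewrite /re_scalar /real_scalar; case: k. Qed.

Lemma re_scalarK (z : K) : 0 <= z -> real_scalar (re_scalar z) = z.
Proof.
rewrite /re_scalar /real_scalar; case: k z => //= -[a b].
by rewrite lecE/= => /andP[/eqP -> _].
Qed.

Lemma real_scalar_le r s : (real_scalar r <= real_scalar s) = (r <= s).
Proof. by rewrite /real_scalar; case: k => //=; exact: lecR. Qed.

Lemma real_scalar_lt r s : (real_scalar r < real_scalar s) = (r < s).
Proof. by rewrite /real_scalar; case: k => //=; exact: ltcR. Qed.

Lemma real_scalar_ge0 r : (0 <= real_scalar r) = (0 <= r).
Proof. by rewrite -(rmorph0 real_scalar) real_scalar_le. Qed.

Lemma real_scalar_gt0 r : (0 < real_scalar r) = (0 < r).
Proof. by rewrite -(rmorph0 real_scalar) real_scalar_lt. Qed.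

Lemma re_scalarD z w : re_scalar (z + w) = re_scalar z + re_scalar w.
Proof. by rewrite /re_scalar; case: k z w => //= -[a b] [c d]. Qed.

Lemma re_scalar_le_norm (z : K) : real_scalar (re_scalar z) <= `|z|.
Proof.
rewrite /re_scalar /real_scalar; case: k z => [z|z] /=; first exact: ler_norm.
case: z => a b; rewrite lecE/= eqxx/=.
by rewrite (le_trans (ler_norm a))// -sqrtr_sqr ler_wsqrtr// lerDl sqr_ge0.
Qed.

Lemma re_scalar_mono (z w : K) : 0 <= z -> z <= w -> re_scalar z <= re_scalar w.
Proof.
by move=> z0 zw; rewrite -real_scalar_le !re_scalarK// (le_trans z0).
Qed.

Section real_norm.
Context {V : normedModType K}.
Implicit Types x y : V.

(** Complex scalars are only partially ordered; a real-valued norm makes linear arithmetic and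
    suprema available. *)
Definition nrm x : R := re_scalar `|x|.

Lemma nrmE x : real_scalar (nrm x) = `|x|.
Proof. exact: re_scalarK. Qed.

Lemma nrm_ge0 x : 0 <= nrm x.
Proof. by rewrite -real_scalar_ge0 nrmE. Qed.

Lemma nrmD x y : nrm (x + y) <= nrm x + nrm y.
Proof. by rewrite -real_scalar_le rmorphD !nrmE ler_normD. Qed.

Lemma nrmN x : nrm (- x) = nrm x.
Proof. by rewrite /nrm normrN. Qed.

Lemma nrm0 : nrm 0 = 0.
Proof. by rewrite -(real_scalarK 0) rmorph0 -(normr0 V). Qed.

Lemma nrm_eq0 x : nrm x = 0 -> x = 0.
Proof. by move=> x0; apply/normr0_eq0; rewrite -nrmE x0 rmorph0. Qed.

Lemma nrmB x y : nrm (x - y) = nrm (y - x).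
Proof. by rewrite -nrmN opprB. Qed.

Lemma nrm_triangle y x z : nrm (x - z) <= nrm (x - y) + nrm (y - z).
Proof. by apply: le_trans (nrmD _ _); rewrite addrA subrK. Qed.

Lemma nrmZ r x : 0 <= r -> nrm (real_scalar r *: x) = r * nrm x.
Proof.
move=> r0; rewrite -[RHS]real_scalarK rmorphM nrmE /nrm normrZ ger0_norm//.
by rewrite real_scalar_ge0.
Qed.

Lemma nrm_sublinear : sublinear real_scalar nrm.
Proof. by split=> [|t x t0]; [exact: nrmD|rewrite nrmZ]. Qed.

Lemma bounded_setP (A : set V) :
  bounded_set A <-> exists M, forall x, A x -> nrm x <= M.
Proof.
split=> [[M0 [M0r AM]]|[M AM]].
  have /AM{}AM : M0 < M0 + 1 by rewrite ltrDl.
  exists (re_scalar (M0 + 1)) => x Ax.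
  by apply: re_scalar_mono => //; exact: AM.
exists (real_scalar M); split.
  rewrite realE !(real_scalar_ge0, =^~ (rmorph0 real_scalar)) !real_scalar_le.
  exact: le_total.
move=> N MN x Ax; apply/ltW/(le_lt_trans _ MN).
by rewrite -nrmE real_scalar_le; exact: AM.
Qed.

Lemma closure_nrmP (A : set V) u :
  closure A u <-> forall e, 0 < e -> exists2 a, A a & nrm (u - a) < e.
Proof.
split=> [Au e e0|H B /nbhs_ballP[e /= e0 eB]].
  have e0' : 0 < real_scalar e by rewrite real_scalar_gt0.
  have [a [Aa]] := Au _ (nbhsx_ballx u _ e0').
  by rewrite -ball_normE/= -nrmE real_scalar_lt; exists a.
have [|a Aa ae] := H (re_scalar e); first by rewrite -real_scalar_gt0 re_scalarK// ltW.
exists a; split=> //; apply: eB; rewrite -ball_normE/= -nrmE.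
by rewrite -(re_scalarK (ltW e0)) real_scalar_lt.
Qed.

End real_norm.
End scalars.

(** * Sequences with geometrically decreasing increments *)

Section geometric.
Context {R : realType}.

Lemma geometric_small (c e : R) : 0 < e -> exists m, c * 2^-1 ^+ m < e.
Proof.
move=> e0; exists (Num.truncn `|c / e|).+1.
rewrite exprVn ltr_pdivrMr ?exprn_gt0// -ltr_pdivrMl// mulrC.
apply: le_lt_trans (ler_norm _) _; apply: lt_trans (truncnS_gt _) _.
by rewrite -natrX ltr_nat ltn_expl.
Qed.

Lemma geometric_le0 (x c : R) : (forall m, x <= c * 2^-1 ^+ m) -> x <= 0.
Proof.
move=> xc; rewrite leNgt; apply/negP => /(geometric_small c)[m].
by rewrite ltNge xc.
Qed.

Lemma geometric_ge0 m : 0 <= (2^-1 : R) ^+ m.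
Proof. by rewrite exprn_ge0. Qed.

Lemma geometric_gt0 m : 0 < (2^-1 : R) ^+ m.
Proof. by rewrite exprn_gt0// invr_gt0. Qed.

Lemma geometric_le1 m : (2^-1 : R) ^+ m <= 1.
Proof. by rewrite exprn_ile1//; lra. Qed.

Lemma geometric_limit {k : scalar_kind}
    {Y : completeNormedModType (scalar_field R k)} (u : nat -> Y) c :
  (forall m, nrm (u m - u m.+1) <= c * 2^-1 ^+ m) ->
  exists l, forall m, nrm (u m - l) <= 2 * c * 2^-1 ^+ m.
Proof.
move=> uc.
have c0 : 0 <= c by have := uc 0%N; rewrite expr0 mulr1; apply: le_trans; exact: nrm_ge0.
have umn m n : nrm (u m - u (m + n)%N) <= 2 * c * 2^-1 ^+ m - 2 * c * 2^-1 ^+ (m + n).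
  elim: n => [|n IH]; first by rewrite addn0 !subrr nrm0.
  apply: le_trans (nrm_triangle (u (m + n)%N) _ _) _.
  by have := uc (m + n)%N; rewrite addnS exprS; lra.
have umn' m n : (m <= n)%N -> nrm (u m - u n) <= 2 * c * 2^-1 ^+ m.
  move=> mn; have := umn m (n - m)%N; rewrite subnKC//.
  by have := mulr_ge0 c0 (geometric_ge0 n); lra.
have /cauchy_cvgP/cvg_ex[l ul] : cauchy (u @ \oo).
  apply: cauchy_exP => e e0.
  have [|m mlt] := @geometric_small (2 * c) (re_scalar e).
    by rewrite -(real_scalar_gt0 (k := k)) re_scalarK// ltW.
  exists (u m); exists m => //= n mn; rewrite -ball_normE/= -nrmE.
  rewrite -(re_scalarK (ltW e0)) real_scalar_lt.
  exact: le_lt_trans (umn' _ _ mn) mlt.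
exists l => m; apply/ler_addgt0Pr => e e0.
have e0' : 0 < real_scalar e :> scalar_field R k by rewrite real_scalar_gt0.
have [N _ Nl] := (cvgrPdist_lt _ _).1 ul _ e0'.
have := Nl (maxn m N) (leq_maxr _ _); rewrite /= -nrmE real_scalar_lt nrmB => lN.
apply: le_trans (nrm_triangle (u (maxn m N)) _ _) _.
by apply: lerD; [exact: umn' (leq_maxl _ _)|exact: ltW].
Qed.

Lemma geometric_limit_real (u : nat -> R) c :
  (forall m, `|u m - u m.+1| <= c * 2^-1 ^+ m) ->
  exists l, forall m, `|u m - l| <= 2 * c * 2^-1 ^+ m.
Proof. exact: (@geometric_limit RealScalars R^o). Qed.

Lemma geometric_eq (x y c : R) : (forall m, `|x - y| <= c * 2^-1 ^+ m) -> x = y.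
Proof. by move=> /geometric_le0; rewrite normr_le0 subr_eq0 => /eqP. Qed.

End geometric.

(* Binary trees rather than weighted lists: no renormalisation of the weights is
   needed to see that a convex set contains the barycentre. *)
Inductive bary (R T : Type) := Pt of T | Mix of R & bary R T & bary R T.

(** * Barycentres, separation from them, and bushes *)

Section barycentres.
Context {R : realType} {k : scalar_kind}.
Local Notation K := (scalar_field R k).
Context {T : Type} {Y : normedModType K}.
Local Notation j := (@real_scalar R k).
Implicit Types (c : bary R T) (f g : T -> Y) (Q : set T).

(** Leaves are labels read through [f], so that the same weights can be applied to successive
    approximations of the nodes. *)
Fixpoint bary_eval f c : Y :=
  match c with
  | Pt x => f x
  | Mix t c1 c2 => j t *: bary_eval f c1 + j (1 - t) *: bary_eval f c2
  end.

Fixpoint bary_in Q c : Prop :=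
  match c with
  | Pt x => Q x
  | Mix t c1 c2 => [/\ 0 <= t, t <= 1, bary_in Q c1 & bary_in Q c2]
  end.

Lemma bary_eval_dist f g Q c e : bary_in Q c ->
  (forall b, Q b -> nrm (f b - g b) <= e) ->
  nrm (bary_eval f c - bary_eval g c) <= e.
Proof.
move=> + Qe; elim: c => [x|t c1 IH1 c2 IH2] /=; first exact: Qe.
move=> [t0 t1 /IH1 e1 /IH2 e2]; rewrite opprD addrACA -!scalerBr.
apply: le_trans (nrmD _ _) _; rewrite !nrmZ ?subr_ge0//.
have -> : e = t * e + (1 - t) * e by ring.
by apply: lerD; rewrite ler_wpM2l// subr_ge0.
Qed.

Lemma bary_eval_convex f Q (C : set Y) c : convex_set C -> bary_in Q c ->
  (forall b, Q b -> C (f b)) -> C (bary_eval f c).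
Proof.
move=> cC + QC; elim: c => [x|t c1 IH1 c2 IH2] /=; first exact: QC.
move=> [t0 t1 /IH1 C1 /IH2 C2].
have jt0 : 0 <= j t by rewrite real_scalar_ge0.
have jt1 : j t <= 1 by rewrite -(rmorph1 j) real_scalar_le.
have := cC _ _ (Itv01 jt0 jt1) (mem_set C1) (mem_set C2).
by rewrite inE /conv/= rmorphB rmorph1.
Qed.

End barycentres.

(** The norm is convolved with the cone of multiples of the pairs [(a - c, - e)], where [c] is a
    barycentre; a linear functional below the result satisfies [l (b - a) <= - e]. The cone is
    closed under sums since [s (a - c) + t (a - d)] is [s + t] times [a] minus the barycentre of [c]
    and [d] with weight [s / (s + t)]. *)
Lemma separation (R : realType) (k : scalar_kind)
    (Y : normedModType (scalar_field R k)) (Q : set Y) (a : Y) (e : R) :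
  0 <= e -> (forall c, bary_in Q c -> e <= nrm (a - bary_eval id c)) ->
  exists l, [/\ real_linear real_scalar l, forall y, l y <= nrm y &
                forall b, Q b -> l b + e <= l a].
Proof.
move=> e0 Qe.
pose j := @real_scalar R k.
pose W := [set w : Y * R | w = (0, 0) \/ exists2 s, 0 <= s & exists2 c, bary_in Q c &
  w = (j s *: (a - bary_eval id c), - (s * e))].
have Wpos s c : 0 <= s -> bary_in Q c -> W (j s *: (a - bary_eval id c), - (s * e)).
  by move=> s0 Qc; right; exists s => //; exists c.
have [||||p [sp pn pW]] := @sublinear_cone _ _ _ _ _ W (nrm_sublinear (V := Y)).
- by left.
- move=> _ w2 [->|[s s0 [c Qc ->]]] Ww2; first by rewrite /= !add0r -surjective_pairing.
  case: Ww2 => [->|[t t0 [d Qd ->]]] /=; first by rewrite !addr0; exact: Wpos.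
  (* The weight [s / (s + t)] makes sense only if [s + t] is nonzero; otherwise both coefficients
     vanish. *)
  have [st0|st0] := leP (s + t) 0.
    have -> : s = 0 by lra.
    have -> : t = 0 by lra.
    by rewrite rmorph0 !scale0r !mul0r oppr0 !addr0; left.
  have -> : j s *: (a - bary_eval id c) + j t *: (a - bary_eval id d) =
      j (s + t) *: (a - bary_eval id (Mix (s / (s + t)) c d)).
    rewrite /= [RHS]scalerBr [in RHS]scalerDr !scalerA -!rmorphM.
    have -> : (s + t) * (s / (s + t)) = s by rewrite mulrC divfK ?gt_eqF.
    have -> : (s + t) * (1 - s / (s + t)) = t.
      by rewrite mulrBr mulrC (mulrC _ (s / _)) divfK ?gt_eqF//; ring.
    by rewrite rmorphD scalerDl !scalerBr opprD addrACA.
  have -> : - (s * e) - t * e = - ((s + t) * e) by ring.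
  apply: Wpos; first exact: ltW.
  split=> //; first by rewrite divr_ge0// ltW.
  by rewrite ler_pdivrMr// mul1r lerDl.
- move=> t w t0 [->|[s s0 [c Qc ->]]] /=; first by rewrite scaler0 mulr0; left.
  by rewrite scalerA -rmorphM mulrN mulrA; apply: Wpos => //; exact: mulr_ge0.
- move=> w [->|[s s0 [c Qc ->]]] /=; first by rewrite nrm0 addr0.
  by rewrite nrmZ// -mulrBr mulr_ge0// subr_ge0; exact: Qe.
have [l ll lp] := hahn_banach sp; exists l; split=> // [y|b Qb].
  exact: le_trans (lp y) (pn y).
have := pW _ (Wpos 1 (Pt R b) ler01 Qb); rewrite /= rmorph1 scale1r opprB mul1r => pab.
have := lp (b - a); have := ll.1 (b - a) a; rewrite subrK; lra.
Qed.

(** The errors are summable, so passing to the limit moves each node by at most [d / 8] and makes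
    every node an exact barycentre of its children. The children remain far from it, so no point of
    the new set can be cut off from the others. *)
Lemma bush_not_dentable (R : realType) (k : scalar_kind)
    (Y : completeNormedModType (scalar_field R k)) (P : nat -> set Y) (M d : R) :
  0 < d -> P 0%N !=set0 -> (forall n a, P n a -> nrm a <= M) ->
  (forall n a, P n a -> exists2 c,
    bary_in [set b | P n.+1 b /\ d <= nrm (b - a)] c &
    nrm (a - bary_eval id c) <= d / 16 * 2^-1 ^+ n) ->
  ~ RNP Y.
Proof.
move=> d0 [a0 Pa0] PM Pbush RY.
have /choice[T PT] : forall p : nat * Y, exists c, P p.1 p.2 ->
    bary_in [set b | P p.1.+1 b /\ d <= nrm (b - p.2)] c /\
    nrm (p.2 - bary_eval id c) <= d / 16 * 2^-1 ^+ p.1.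
  (* Outside [P n] the one-leaf tree is a dummy value. *)
  move=> [n a]; have [Pa|nPa] := pselect (P n a); last by exists (Pt R a).
  by have [c c1 c2] := Pbush _ _ Pa; exists c.
(* [E m n a] is the barycentre of the descendants of [a] after [m] generations. *)
pose E := fix E m n a :=
  if m is m'.+1 then bary_eval (E m' n.+1) (T (n, a)) else a.
have EE m n a : P n a ->
    nrm (E m n a - E m.+1 n a) <= d / 16 * 2^-1 ^+ n * 2^-1 ^+ m.
  elim: m n a => [|m IH] n a Pa; first by rewrite expr0 mulr1; exact: (PT (n, a) Pa).2.
  apply: (bary_eval_dist (PT (n, a) Pa).1) => b [Pb _].
  apply: le_trans (IH _ _ Pb) _; rewrite !exprS; lra.
have /choice[L' PL'] : forall p : nat * Y, exists l, P p.1 p.2 ->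
    forall m, nrm (E m p.1 p.2 - l) <= d / 8 * 2^-1 ^+ m.
  move=> [n a]; have [Pa|nPa] := pselect (P n a); last by exists a.
  have [l El] := geometric_limit (fun m => EE m n a Pa).
  exists l => _ m; apply: le_trans (El m) _; rewrite ler_wpM2r ?geometric_ge0//.
  have := geometric_le1 (R := R) n; have := geometric_ge0 (R := R) n.
  by rewrite mulrA; nra.
pose L n a := L' (n, a).
have PL n a m : P n a -> nrm (E m n a - L n a) <= d / 8 * 2^-1 ^+ m.
  by move=> Pa; exact: (PL' (n, a) Pa).
have La n a : P n a -> nrm (a - L n a) <= d / 8.
  by move=> Pa; have := PL _ _ 0%N Pa; rewrite expr0 mulr1.
(* [E m.+1 n a] is the barycentre of the values [E m n.+1 b] at the children, and it converges to
   both sides. *)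
have LE n a : P n a -> L n a = bary_eval (L n.+1) (T (n, a)).
  move=> Pa; apply/eqP; rewrite -subr_eq0; apply/eqP/nrm_eq0.
  apply/eqP; rewrite eq_le nrm_ge0 andbT.
  apply: (@geometric_le0 _ _ (d / 4)) => m.
  apply: le_trans (nrm_triangle (E m.+1 n a) _ _) _.
  have := PL _ _ m.+1 Pa; rewrite nrmB exprS.
  have : nrm (E m.+1 n a - bary_eval (L n.+1) (T (n, a))) <= d / 8 * 2^-1 ^+ m.
    apply: (bary_eval_dist (PT (n, a) Pa).1) => b [Pb _]; exact: PL.
  have := mulr_ge0 (ltW d0) (geometric_ge0 (R := R) m); lra.
pose A := [set x | exists n a, P n a /\ x = L n a].
have Ab : bounded_set A.
  apply/bounded_setP; exists (M + d / 8) => _ [n [a [Pa ->]]].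
  have := nrmD a (L n a - a); rewrite addrC subrK.
  by have := PM _ _ Pa; have := La _ _ Pa; rewrite nrmB; lra.
have An0 : A !=set0 by exists (L 0%N a0), 0%N, a0.
(* The scale [d / 2] works because the limits of a node and of its child are at distance at least
   [d - d / 8 - d / 8]. *)
have d2 : 0 < @real_scalar R k (d / 2) by rewrite real_scalar_gt0; lra.
have [_ [n [a [Pa ->]]]] := RY A An0 Ab _ d2; apply => C [[_ cC] AC].
rewrite LE//; apply: (bary_eval_convex cC (PT (n, a) Pa).1) => b [Pb /= dab].
apply: AC; split; first by exists n.+1, b.
rewrite /= -nrmE real_scalar_lt => lt2.
have := nrm_triangle (L n.+1 b) b a.
have := nrm_triangle (L n a) (L n.+1 b) a.
have := La _ _ Pa; have := La _ _ Pb; rewrite (nrmB a); lra.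
Qed.

(** * Stegall's variational principle *)

Section stegall.
Context {R : realType} {k : scalar_kind} {Y : completeNormedModType (scalar_field R k)}.
Implicit Types (h l psi : Y -> R) (D : set Y).

(** The one-sided bound controls the dual norm, since [h] is odd. *)
Definition real_functional c h :=
  real_linear real_scalar h /\ forall y, h y <= c * nrm y.

Lemma real_linearN h y : real_linear real_scalar h -> h (- y) = - h y.
Proof.
by case=> _ /(_ (-1) y); rewrite rmorphN rmorph1 scaleN1r mulN1r.
Qed.

Lemma real_linearB h x y : real_linear real_scalar h -> h (x - y) = h x - h y.
Proof. by move=> lh; rewrite lh.1 real_linearN. Qed.

Lemma real_functional_norm c h y : real_functional c h -> `|h y| <= c * nrm y.
Proof.
move=> [lh hc]; rewrite ler_norml hc andbT.
by have := hc (- y); rewrite real_linearN// nrmN; lra.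
Qed.

Lemma real_functional0 : real_functional 0 (fun=> 0).
Proof. by split=> [|y]; [split=> *; rewrite ?addr0 ?mulr0|rewrite mul0r]. Qed.

Lemma real_functionalD a b h l t : 0 <= t ->
  real_functional a h -> real_functional b l ->
  real_functional (a + t * b) (fun y => h y + t * l y).
Proof.
move=> t0 [lh hc] [ll lc]; split; first split=> [x y|r x].
- by rewrite lh.1 ll.1; ring.
- by rewrite lh.2 ll.2; ring.
- by move=> y; have := hc y; have := ler_wpM2l t0 (lc y); lra.
Qed.

(** For linear [psi] this is a slice of [D], written without naming the supremum. *)
Definition slice D psi (a : R) :=
  [set y | D y /\ forall z, D z -> psi z <= psi y + a].

Lemma slice_nonempty D psi a : D !=set0 -> has_ubound (psi @` D) -> 0 < a ->
  slice D psi a !=set0.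
Proof.
move=> [y0 Dy0] psib a0.
have [|_ [y Dy <-] ylt] := @sup_adherent _ (psi @` D) a a0.
  by split=> //; exists (psi y0), y0.
exists y; split=> // z Dz.
have : psi z <= sup (psi @` D) by apply: ub_le_sup => //; exists z.
by lra.
Qed.

Lemma slice_le D psi a b : a <= b -> slice D psi a `<=` slice D psi b.
Proof. by move=> ab y [Dy ya]; split=> // z /ya; lra. Qed.

Lemma ubound_functional D psi c h M : 0 <= c -> (forall y, D y -> nrm y <= M) ->
  has_ubound (psi @` D) -> real_functional c h ->
  has_ubound ((fun y => psi y + h y) @` D).
Proof.
move=> c0 DM [N psiN] [_ hc]; exists (N + c * M) => _ [y Dy <-].
apply: lerD; first by apply: psiN; exists y.
by apply: le_trans (hc y) _; rewrite ler_wpM2l// DM.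
Qed.

(* If every slice is large, the almost maximisers of the perturbed functions form
   an approximate bush: a point far from the barycentres of the next level
   would be separated from them by a functional, and moving the perturbation a
   little in that direction yields a small slice. *)
Lemma small_slice D psi M t d : RNP Y -> D !=set0 ->
  (forall y, D y -> nrm y <= M) -> has_ubound (psi @` D) -> 0 < t -> 0 < d ->
  exists h a, [/\ real_functional t h, 0 < a & forall y z,
    slice D (fun x => psi x + h x) a y -> slice D (fun x => psi x + h x) a z ->
    nrm (y - z) <= d].
Proof.
move=> RY D0 DM psib t0 d0; apply: contrapT => nosmall.
have large h a : real_functional t h -> 0 < a ->
    exists y z, [/\ slice D (fun x => psi x + h x) a y,
      slice D (fun x => psi x + h x) a z & d < nrm (y - z)].
  move=> th a0; apply: contrapT => noyz; apply: nosmall; exists h, a; split=> // y z ys zs.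
  by rewrite leNgt; apply/negP => yz; apply: noyz; exists y, z.
pose g n := (2^-1 : R) ^+ n.
have g1 n : 0 < g n <= 1 by rewrite geometric_gt0 geometric_le1.
have gS n : g n.+1 = g n / 2 by rewrite /g exprS mulrC.
(* Separation will yield a gain of [t * d / 64 * (g n * g n)], which has to exceed [al n + al n.+1];
   hence the quadratic decay. *)
pose al n := t * d / 256 * (g n * g n).
have al0 n : 0 < al n.
  by have /andP[gn _] := g1 n; rewrite !mulr_gt0.
(* At level [n] a norm of [t * g n] is still available for perturbations; passing to the next level
   spends half of it. *)
pose P n := [set y | exists2 h, real_functional (t - t * g n) h &
   slice D (fun x => psi x + h x) (al n) y].
apply: (@bush_not_dentable _ _ Y P M (d / 2)) RY; first lra.
- have [y ys] := slice_nonempty D0 psib (al0 0%N); exists y, (fun=> 0).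
    by rewrite /g expr0 mulr1 subrr; exact: real_functional0.
  by have [? yz] := ys; split=> // z /yz; rewrite !addr0.
- by move=> n a [h _ [Da _]]; exact: DM.
move=> n a [h th [Da ah]]; apply: contrapT => noc.
pose Q := [set b | P n.+1 b /\ d / 2 <= nrm (b - a)].
have [||l [ll lnrm lQ]] := @separation _ _ _ Q a (d / 2 / 16 * g n).
- by have /andP[gn _] := g1 n; apply/ltW; rewrite !mulr_gt0.
- move=> c Qc; rewrite leNgt; apply/negP => /ltW ac; apply: noc; exists c => //.
have /andP[gn0 gn1] := g1 n.
pose s := t * g n.+1.
have s0 : 0 < s by rewrite mulr_gt0// geometric_gt0.
have th' : real_functional (t - t * g n.+1) (fun x => h x + s * l x).
  have -> : t - t * g n.+1 = t - t * g n + s * 1 by rewrite /s !gS; lra.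
  apply: real_functionalD => //; first exact: ltW.
  by split=> // y; rewrite mul1r.
have [|y [z [ys zs yz]]] := large (fun x => h x + s * l x) _ _ (al0 n.+1).
  split; first exact: th'.1.
  move=> y; apply: le_trans (th'.2 y) _; rewrite ler_wpM2r ?nrm_ge0//.
  by have := s0; rewrite /s; lra.
(* Of two points more than [d] apart, one is at distance at least [d / 2] from [a]. *)
have [b [bs ba]] : exists b, slice D (fun x => psi x + (h x + s * l x)) (al n.+1) b /\
    d / 2 <= nrm (b - a).
  have [ya|ya] := leP (d / 2) (nrm (y - a)); first by exists y.
  exists z; split=> //; have := nrm_triangle a y z; rewrite (nrmB a z); lra.
have lb : l b + d / 2 / 16 * g n <= l a by apply: lQ; split=> //; exists (fun x => h x + s * l x).
have := ah _ bs.1; have := bs.2 _ Da.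
rewrite /al gS.
have : s * (l b + d / 2 / 16 * g n) <= s * l a by rewrite ler_wpM2l// ltW.
have : 0 < t * d * (g n * g n) by rewrite !mulr_gt0.
rewrite /s gS; lra.
Qed.

(** Summable perturbations produce nested slices with diameters and heights tending to 0. Points
    chosen in them converge by completeness, and the limit maximises the limit function. *)
Lemma stegall D psi M t : RNP Y -> D !=set0 -> closed D ->
  (forall y, D y -> nrm y <= M) -> (forall y z, psi y - psi z <= nrm (y - z)) ->
  0 < t ->
  exists h y0, [/\ real_functional t h, D y0 &
    forall y, D y -> psi y + h y <= psi y0 + h y0].
Proof.
move=> RY D0 Dcl DM psi1 t0.
wlog M0 : M DM / 0 < M.
  move=> /(_ (Num.max M 1)); apply; last by rewrite lt_max ltr01 orbT.
  by move=> y /DM yM; rewrite le_max yM.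
have psib : has_ubound (psi @` D).
  exists (psi 0 + M) => _ [y Dy <-]; have := psi1 y 0; rewrite subr0.
  by have := DM _ Dy; lra.
pose g n := (2^-1 : R) ^+ n.
have g0 n : 0 < g n by exact: geometric_gt0.
have gS n : g n.+1 = g n / 2 by rewrite /g exprS mulrC.
pose sl (p : (Y -> R) * R) := slice D (fun x => psi x + p.1 x) p.2.
pose good n (p : (Y -> R) * R) :=
  [/\ real_functional (t - t * g n) p.1, 0 < p.2 & p.2 <= g n].
pose next n (p q : (Y -> R) * R) :=
  [/\ forall x, `|p.1 x - q.1 x| <= t * nrm x * g n, sl q `<=` sl p &
      forall y z, sl q y -> sl q z -> nrm (y - z) <= g n].
have tg n : 0 <= t - t * g n by rewrite subr_ge0 ler_piMr ?geometric_le1// ltW.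
have step n p : good n p -> exists q, good n.+1 q /\ next n p q.
  case: p => h a [/= th a0 ag].
  (* The first bound keeps the total norm below [t - t * g n.+1]; the second makes the new
     functional at most [a / 4] in absolute value on [D]. *)
  pose r := Num.min (t * g n.+1) (a / (4 * M)).
  have r0 : 0 < r by rewrite lt_min !mulr_gt0 ?invr_gt0 ?mulr_gt0//; apply: g0.
  have rt : r <= t * g n.+1 by rewrite ge_min lexx.
  have rM : r * M <= a / 4.
    have : r <= a / (4 * M) by rewrite ge_min lexx orbT.
    by rewrite ler_pdivlMr ?mulr_gt0//; lra.
  have [l [b [tl b0 small]]] := small_slice RY D0 DM
    (ubound_functional (tg n) DM psib th) r0 (g0 n).
  have lM y : D y -> `|l y| <= a / 4.
    move=> Dy; apply: le_trans (real_functional_norm y tl) _; apply: le_trans rM.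
    by rewrite ler_wpM2l ?(ltW r0)// DM.
  (* Height [b] gives the small diameter. Height [a / 2], plus [a / 4] at each of two points, keeps
     the new slice inside the old one of height [a]. *)
  pose c := Num.min b (a / 2).
  have c0 : 0 < c by rewrite lt_min b0; lra.
  have cb : c <= b by rewrite ge_min lexx.
  have ca : c <= a / 2 by rewrite ge_min lexx orbT.
  exists (fun x => h x + 1 * l x, c).
  have slE : sl (fun x => h x + 1 * l x, c) = slice D (fun x => psi x + h x + l x) c.
    by congr slice; apply/funext => x /=; ring.
  split; split=> //=.
  - have [lh hb] := real_functionalD ler01 th tl; split=> // x.
    apply: le_trans (hb x) _; rewrite ler_wpM2r ?nrm_ge0//.
    by have := gS n; have := rt; nra.
  - by rewrite gS; lra.
  - move=> x; have -> : h x - (h x + 1 * l x) = - l x by ring.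
    rewrite normrN; apply: le_trans (real_functional_norm x tl) _.
    rewrite mulrAC ler_wpM2r ?nrm_ge0//; apply: le_trans rt _.
    by rewrite gS ler_wpM2l ?(ltW t0)//; have := g0 n; lra.
  - rewrite slE => y [Dy ys]; split=> // z Dz /=.
    have := ys z Dz; have /ler_normlP[] := lM _ Dy; have /ler_normlP[] := lM _ Dz.
    by lra.
  - rewrite slE => y z ys zs; apply: small; exact: (slice_le cb).
have /choice[F FP] : forall np : nat * ((Y -> R) * R), exists q,
    good np.1 np.2 -> good np.1.+1 q /\ next np.1 np.2 q.
  move=> [n p]; have [gp|ngp] := pselect (good n p); last by exists p.
  by have [q qP] := step _ _ gp; exists q.
pose s := fix s n : (Y -> R) * R := if n is n'.+1 then F (n', s n') else (fun=> 0, 1).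
have sg n : good n (s n).
  elim: n => [|n IH]; last exact: (FP (n, s n) IH).1.
  split=> //=.
  by rewrite /g expr0 mulr1 subrr; exact: real_functional0.
have sn n : next n (s n) (s n.+1) := (FP (n, s n) (sg n)).2.
(* The index is shifted because the diameter bound [g n] concerns the slice of [s n.+1], which
   contains both [u n] and [u n.+1]. *)
have /choice[u us] : forall n, exists y, sl (s n.+1) y.
  move=> n; have [th a0 _] := sg n.+1.
  exact: slice_nonempty (ubound_functional (tg _) DM psib th) a0.
have [|y0 uy0] := @geometric_limit _ _ _ u 1.
  move=> n; rewrite mul1r; have [_ _] := sn n; apply; first exact: us.
  by have [_ + _] := sn n.+1; apply; exact: us.
have /choice[h hs] : forall x, exists y, forall n,
    `|(s n).1 x - y| <= 2 * (t * nrm x) * 2^-1 ^+ n.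
  by move=> x; apply: geometric_limit_real => n; have [] := sn n.
have Dy0 : D y0.
  rewrite ((closure_id D).1 Dcl); apply/closure_nrmP => e e0.
  have [n lte] := @geometric_small _ (2 * 1) e e0.
  exists (u n); first by have [] := us n.
  by rewrite nrmB; apply: le_lt_trans (uy0 n) lte.
exists h, y0; split=> //; first split; first split.
- move=> x y; apply: (@geometric_eq _ _ _
    (2 * (t * nrm (x + y)) + 2 * (t * nrm x) + 2 * (t * nrm y))) => n.
  have [[[sD _] _] _ _] := sg n.
  have := hs (x + y) n; have := hs x n; have := hs y n; rewrite sD.
  by rewrite !ler_norml => /andP[? ?] /andP[? ?] /andP[? ?]; apply/andP; split; lra.
- move=> r x; apply: (@geometric_eq _ _ _
    (2 * (t * nrm (real_scalar r *: x)) + `|r| * (2 * (t * nrm x)))) => n.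
  have [[[_ sZ] _] _ _] := sg n.
  have := hs (real_scalar r *: x) n; have := ler_wpM2l (normr_ge0 r) (hs x n).
  rewrite sZ -normrM mulrBr.
  by rewrite !ler_norml => /andP[? ?] /andP[? ?]; apply/andP; split; lra.
- move=> x; rewrite -subr_le0; apply: (@geometric_le0 _ _ (2 * (t * nrm x))) => n.
  have [[_ sb] _ _] := sg n; have := hs x n; rewrite ler_norml => /andP[? ?].
  have := sb x; have := mulr_ge0 (mulr_ge0 (ltW t0) (ltW (g0 n))) (nrm_ge0 x); lra.
- move=> y Dy; rewrite -subr_le0.
  (* The first two terms pay for replacing [h] by the functional of [s n.+1] at [y] and [y0], [3]
     for the Lipschitz error and the height of the slice, [2 * t] for the functional at
     [u n - y0]. *)
  apply: (@geometric_le0 _ _ (2 * (t * nrm y) + 2 * (t * nrm y0) + 3 + 2 * t)) => n.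
  have [th _ ag] := sg n.+1; have [_ /(_ y Dy)] := us n.
  have := psi1 (u n) y0; have := uy0 n; have := th.2 (u n - y0).
  rewrite (real_linearB _ _ th.1).
  have : (t - t * g n.+1) * nrm (u n - y0) <= t * (2 * 1 * g n).
    apply: le_trans (ler_wpM2l (tg _) (uy0 n)) _; rewrite ler_wpM2r ?mulr_ge0 ?(ltW (g0 n))//.
    by have := mulr_gt0 t0 (g0 n.+1); lra.
  have := hs y n.+1; have := hs y0 n.+1; rewrite -!/(g _) !gS in ag *.
  rewrite !ler_norml => /andP[? ?] /andP[? ?].
  have := mulr_ge0 (mulr_ge0 (ltW t0) (ltW (g0 n))) (nrm_ge0 y).
  have := mulr_ge0 (mulr_ge0 (ltW t0) (ltW (g0 n))) (nrm_ge0 y0).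
  by have := g0 n; lra.
Qed.

End stegall.

(** * Scalar functionals with given real part, and norms of multilinear maps *)

Lemma phase (K : numFieldType) (z : K) : exists2 u, `|u| = 1 & u * z = `|z|.
Proof.
have [->|z0] := eqVneq z 0; first by exists 1; rewrite ?normr1// mulr0 normr0.
exists (`|z| / z); last by rewrite divfK.
by rewrite normrM normrV ?unitfE// normr_id mulfV// normr_eq0.
Qed.

Lemma nrm_phase (R : realType) (k : scalar_kind) (Y : normedModType (scalar_field R k))
  (u : scalar_field R k) (y : Y) : `|u| = 1 -> nrm (u *: y) = nrm y.
Proof. by move=> u1; rewrite /nrm normrZ u1 mul1r. Qed.

(** In the complex case [g y = h y - i h (i y)]. *)
Lemma scalar_extension (R : realType) (k : scalar_kind)
    (Y : normedModType (scalar_field R k)) (h : Y -> R) :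
  real_linear real_scalar h ->
  exists2 g : Y -> scalar_field R k, scalar g & forall y, re_scalar (g y) = h y.
Proof.
case: k Y h => Y h [hD hZ]; first by exists h => // a x y; rewrite hD -hZ.
pose I : scalar_field R ComplexScalars := 'i%C.
exists (fun y => (h y +i* (- h (I *: y)))%C) => // a x y.
have aE (v : Y) : a *: v =
    real_scalar (complex.Re a) *: v + real_scalar (complex.Im a) *: (I *: v).
  by rewrite scalerA -scalerDl mulrC -complexE.
have iaE : I *: (a *: x) =
    real_scalar (complex.Re a) *: (I *: x) + real_scalar (- complex.Im a) *: x.
  rewrite aE scalerDr !scalerA; congr (_ *: _ + _ *: _); first exact: mulrC.
  by rewrite mulrAC -expr2 sqr_i mulN1r rmorphN.
rewrite scalerDr iaE !hD !hZ aE hD !hZ.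
by case: a {aE iaE} => p q; apply/eqP; rewrite eq_complex /=; apply/andP; split; apply/eqP; ring.
Qed.

(** A rotation [u] makes [g (u *: y)] equal to the modulus of [g y], hence equal to its own real
    part [h (u *: y)]; so [g] inherits the bound of [h]. *)
Lemma scalar_extension_norm (R : realType) (k : scalar_kind)
    (Y : completeNormedModType (scalar_field R k)) (h : Y -> R) c (g : Y -> scalar_field R k) :
  real_functional c h -> scalar g -> (forall y, re_scalar (g y) = h y) ->
  forall y, exists u, [/\ `|u| = 1, re_scalar `|g y| = h (u *: y) &
    re_scalar `|g y| <= c * nrm y].
Proof.
move=> [lh hc] lg gh y; have [u u1 ug] := phase (g y); exists u.
have E : re_scalar `|g y| = h (u *: y).
  have g0 : g 0 = 0 by have := lg (-1) 0 0; rewrite scaler0 addr0 mulN1r addNr.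
  by rewrite -gh -[u *: y]addr0 lg g0 addr0 /= ug.
by split=> //; rewrite E; apply: le_trans (hc _) _; rewrite nrm_phase.
Qed.

Section mnorm.
Context {R : realType} {k : scalar_kind} {n : nat}.
Local Notation K := (scalar_field R k).
Context {X : 'I_n -> normedModType K} {Y : normedModType K}.
Implicit Types A : (forall i, X i) -> Y.

Lemma mnorm_le A (M : R) : (forall x, unit_balls x -> nrm (A x) <= M) ->
  mnorm A <= real_scalar M.
Proof.
move=> AM; have [|_] := @mnormP _ _ _ _ _ A.
  by apply/bounded_setP; exists M => _ [x xB <-]; exact: AM.
by apply=> _ [x xB <-]; rewrite -nrmE real_scalar_le; exact: AM.
Qed.

Lemma mnorm_closure A u : closure (A @` unit_balls) u ->
  (forall x, unit_balls x -> nrm (A x) <= nrm u) -> mnorm A = `|u|.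
Proof.
move=> /closure_nrmP Au ub; apply/eqP; rewrite eq_le -{1}nrmE mnorm_le//=.
have [|Aub _] := @mnormP _ _ _ _ _ A.
  by apply/bounded_setP; exists (nrm u) => _ [x xB <-]; exact: ub.
have AxA x : unit_balls x -> `|A x| <= mnorm A by move=> xB; apply: Aub; exists x.
have m0 : 0 <= mnorm A.
  by apply: le_trans (AxA (fun=> 0) _) => // i; rewrite normr0.
rewrite -nrmE -(re_scalarK m0) real_scalar_le; apply/ler_addgt0Pr => e /Au[_ [x xB <-] uAx].
have := nrmD (u - A x) (A x); rewrite subrK.
have : nrm (A x) <= re_scalar (mnorm A) by apply: re_scalar_mono => //; exact: AxA.
lra.
Qed.

(** The phase is absorbed into the coordinate [i], which stays in its unit ball. *)
Lemma multilinear_phase A (i : 'I_n) (u : K) x : multilinear A -> `|u| = 1 ->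
  unit_balls x -> (A @` unit_balls) (u *: A x).
Proof.
move=> Am u1 xB; exists (dfwith x i (u *: x i)).
  move=> l; case: (dfwithP x (u *: x i)) => [|l' _]; last exact: xB.
  by rewrite normrZ u1 mul1r; exact: xB.
have /= A0 := Am x i (-1) 0 0; rewrite scaler0 addr0 scaleN1r addNr in A0.
have /= := Am x i u (x i) 0; rewrite addr0 A0 addr0 => ->; congr (_ *: A _).
apply/functional_extensionality_dep => l.
by case: (dfwithP x (x i)).
Qed.

End mnorm.

(** * Density, by a rank-one perturbation *)

Theorem corollary3p15 (R : realType) (k : scalar_kind) (n : nat) (n_gt0 : (0 < n)%N)
    (X : 'I_n -> completeNormedModType (scalar_field R k))
    (Y : completeNormedModType (scalar_field R k)) :
  RNP Y ->
  forall A, bounded_multilinear X Y A ->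
  forall e : scalar_field R k, 0 < e ->
  exists2 B, QNA X Y B & mnorm (fun x => A x - B x) < e.
Proof.
move=> RY A [Am /bounded_setP[M0 AM0]] e e_gt0.
have [M AM M_gt0] : exists2 M, forall x, unit_balls x -> nrm (A x) <= M & 0 < M.
  exists (Num.max M0 1); last by rewrite lt_max ltr01 orbT.
  by move=> x xB; rewrite le_max AM0//; exists x.
pose D := closure (A @` unit_balls).
have AD x : unit_balls x -> D (A x) by move=> xB; apply: subset_closure; exists x.
have D0 : D !=set0 by exists (A (fun=> 0)); apply: AD => i; rewrite normr0.
have DM y : D y -> nrm y <= M.
  move=> /closure_nrmP Dy; apply/ler_addgt0Pr => r /Dy[_ [x xB <-] yr].
  by have := nrmD (y - A x) (A x); rewrite subrK; have := AM _ xB; lra.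
(* The perturbation has norm at most [t * M], that is, half of [e]. *)
pose t := re_scalar e / (2 * M).
have re_gt0 : 0 < re_scalar e by rewrite -(real_scalar_gt0 (k := k)) re_scalarK// ltW.
have t_gt0 : 0 < t by rewrite divr_gt0// mulr_gt0.
have tM : t * M < re_scalar e.
  by rewrite /t invfM mulrA divfK ?gt_eqF//; lra.
have nrm1 (y z : Y) : nrm y - nrm z <= nrm (y - z).
  by have := nrmD (y - z) z; rewrite subrK; lra.
have [h [y0 [th Dy0 y0max]]] :=
  stegall RY D0 (@closed_closure _ (A @` unit_balls)) DM nrm1 t_gt0.
have [g lg gh] := scalar_extension th.1.
have gP := scalar_extension_norm th lg gh.
(* If [y0] is 0 then [v] is 0, so only [nrm v <= 1] holds in general. *)
pose v := `|y0|^-1 *: y0.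
have v1 : nrm v <= 1.
  rewrite -(real_scalar_le (k := k)) nrmE rmorph1 normrZ normfV normr_id.
  have [->|y00] := eqVneq `|y0| 0; first by rewrite mulr0.
  by rewrite mulVf.
have gv y : nrm (g y *: v) <= re_scalar `|g y|.
  rewrite -(real_scalar_le (k := k)) nrmE normrZ re_scalarK//.
  by rewrite ler_piMr// -nrmE -(rmorph1 real_scalar) real_scalar_le.
pose B x := A x + g (A x) *: v.
pose u := y0 + g y0 *: v.
(* For nonzero [y0] the norm of [u] is the modulus of [|y0| + g y0], which is at least its real
   part. *)
have uE : nrm y0 + h y0 <= nrm u.
  have [y00|y00] := eqVneq y0 0.
    have -> : h y0 = 0 by have := th.1.2 0 0; rewrite scaler0 mul0r y00.
    by rewrite y00 nrm0 addr0 nrm_ge0.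
  have -> : u = (1 + g y0 / `|y0|) *: y0 by rewrite scalerDl scale1r -scalerA.
  rewrite /nrm normrZ -[X in _ * X]normr_id -normrM mulrDl mul1r.
  rewrite divfK ?normr_eq0// -gh -re_scalarD.
  rewrite -(real_scalar_le (k := k)) [leRHS]re_scalarK//; exact: re_scalar_le_norm.
have Bu x : unit_balls x -> nrm (B x) <= nrm u.
  move=> xB; apply: le_trans (nrmD _ _) _; apply: le_trans uE.
  have [w [w1 wg _]] := gP (A x).
  apply: le_trans (y0max (w *: A x) _).
    by rewrite (nrm_phase _ w1) -wg; apply: lerD => //; exact: gv.
  by apply: subset_closure; exact: multilinear_phase (Ordinal n_gt0) _ _ Am w1 xB.
have uB : closure (B @` unit_balls) u.
  apply/closure_nrmP => r r_gt0.
  (* The map sending [y] to [y + g y *: v] is Lipschitz with constant [1 + t], so it carries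
     approximations of [y0] to approximations of [u]. *)
  have t1 : 0 < 1 + t by lra.
  have [_ [x xB <-] xr] := (closure_nrmP _ _).1 Dy0 (r / (1 + t)) (divr_gt0 r_gt0 t1).
  exists (B x); first by exists x.
  have -> : u - B x = (y0 - A x) + g (y0 - A x) *: v.
    have -> : g (y0 - A x) = g y0 - g (A x).
      by rewrite addrC -scaleN1r lg mulN1r addrC.
    by rewrite /u /B scalerBl opprD addrACA.
  apply: le_lt_trans (nrmD _ _) _; have [_ [_ _ gt]] := gP (y0 - A x).
  have := gv (y0 - A x); rewrite ltr_pdivlMr// in xr; lra.
exists B; first split; first split.
- move=> x i a y z /=; rewrite /B Am lg; set p := A _; set q := A _.
  by rewrite scalerDl -scalerA scalerDr addrACA.
- by apply/bounded_setP; exists (nrm u) => _ [x xB <-]; exact: Bu.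
- by exists u => //; rewrite (mnorm_closure uB Bu).
apply: (@le_lt_trans _ _ (real_scalar (t * M))).
  apply: mnorm_le => x xB; rewrite /B opprD addrA subrr add0r nrmN.
  apply: le_trans (gv _) _; have [_ [_ _ gt]] := gP (A x).
  by apply: le_trans gt _; rewrite ler_wpM2l ?(ltW t_gt0)// AM.
by rewrite -(re_scalarK (ltW e_gt0)) real_scalar_lt.
Qed.
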